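(* Let $\varphi$ be a complete Bernstein function of the form $\varphi(x)=\int_0^\infty(1-e^{-sx})\overline\nu(s)\,ds$, with $\overline\nu$ a completely monotone Lévy density, such that $\lim_{\theta\to0}\varphi(\theta)=0$, $\lim_{\theta\to\infty}\varphi(\theta)=+\infty$, $\lim_{\theta\to0}\varphi(\theta)/\theta=+\infty$ and $\lim_{\theta\to\infty}\varphi(\theta)/\theta=0$. Let $\kappa$ be the function with Laplace transform $1/\varphi$ and $\chi(x)=\int_0^x\kappa(z)dz$. Assume that for every $\varepsilon>0$ one has $\kappa\in L^1(0,\varepsilon)\cap L^2(\varepsilon,\infty)$ and $\chi\in L^2(0,\varepsilon)$. Then the process $$B_t^\kappa=\sqrt{C_\kappa}\int_{\mathbb R}\big[\chi((t-u)_+)-\chi((-u)_+)\big]dW_u,\qquad t\ge0,$$ displays long-range dependence, i.e. $\sum_{n=1}^\infty|\rho_n|=+\infty$, where $\rho_n:=\mathbb E\big[B_1^\kappa(B_{n+1}^\kappa-B_n^\kappa)\big]$.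
   Context: A Lévy density satisfies $\int_0^\infty(s\wedge1)\overline\nu(s)ds<\infty$. $\kappa:(0,\infty)\to[0,\infty)$ is the (locally integrable, non-increasing) function with $\int_0^\infty e^{-s\theta}\kappa(s)ds=1/\varphi(\theta)$ for $\theta>0$; it exists because $\varphi$ is complete Bernstein, and is the Sonine associate of $\nu(x)=\int_x^\infty\overline\nu(z)dz$. $\chi(x)=0$ for $x\le0$, $(x)_+=\max(x,0)$. $W=(W_u)_{u\in\mathbb R}$ is a two-sided Wiener process, and $C_\kappa=\big(\int_{\mathbb R}[\chi((1-u)_+)-\chi((-u)_+)]^2du\big)^{-1}$ is a normalising constant. Under the stated hypotheses the integrand is in $L^2(\mathbb R)$ for every $t\ge0$. *)

(* Defs.v *)
From HB Require Import structures.
From mathcomp Require Import all_boot all_order all_algebra.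
From mathcomp Require Import all_classical all_reals all_analysis.

Set Implicit Arguments.
Unset Strict Implicit.
Unset Printing Implicit Defensive.

Import Order.TTheory GRing.Theory Num.Theory.
Import numFieldNormedType.Exports.

Local Open Scope classical_set_scope.
Local Open Scope ring_scope.

(** Functions on (0, +oo) are represented by total functions [R -> R] whose
    values outside (0, +oo) are irrelevant. *)

Section BernsteinFunctions.
Variable R : realType.
Implicit Types (phi nu kappa : R -> R) (D : set R).

Local Notation mu := (@lebesgue_measure R).

Definition completely_monotone nu : Prop :=
  forall (n : nat) (x : R), 0 < x ->
    derivable (nu^`(n))%classic x 1 /\ 0 <= (-1) ^+ n * (nu^`(n))%classic x.

Definition levy_density nu : Prop :=
  [/\ forall s : R, 0 < s -> 0 <= nu s,
      measurable_fun (`]0, +oo[ : set R) nu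
    & (\int[mu]_(s in `]0%R, +oo[) (Num.min s 1 * nu s)%:E < +oo)%E].

(* the Bernstein function with Levy density [nu], no killing and no drift *)
Definition levy_exponent nu (x : R) : \bar R :=
  (\int[mu]_(s in `]0%R, +oo[) ((1 - expR (- (s * x))) * nu s)%:E)%E.

Definition complete_bernstein phi : Prop :=
  exists (a b : R) nu, [/\ 0 <= a, 0 <= b, completely_monotone nu, levy_density nu
    & forall x : R, 0 < x -> (phi x)%:E = ((a + b * x)%:E + levy_exponent nu x)%E].

Definition laplace kappa (theta : R) : \bar R :=
  (\int[mu]_(s in `]0%R, +oo[) (expR (- (s * theta)) * kappa s)%:E)%E.

(* By uniqueness of Laplace transforms these conditions determine [kappa]
   almost everywhere on (0, +oo). *)
Definition inverse_laplace_kernel phi kappa : Prop :=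
  [/\ forall s : R, 0 < s -> 0 <= kappa s,
      forall r s : R, 0 < r -> r <= s -> kappa s <= kappa r,
      locally_integrable `]0, +oo[ kappa
    & forall theta : R, 0 < theta -> laplace kappa theta = ((phi theta)^-1)%:E].

Definition Lp_on (p : \bar R) D (f : R -> R) : Prop := f \_ D \in Lfun mu p.

(* For [x <= 0] the domain is empty, so [chi kappa x = 0]. *)
Definition chi kappa (x : R) : R := \int[mu]_(z in `]0, x]) kappa z.

Definition ma_kernel kappa (t u : R) : R :=
  chi kappa (Num.max (t - u) 0) - chi kappa (Num.max (- u) 0).

Definition norm_const kappa : R := (\int[mu]_u (ma_kernel kappa 1 u) ^+ 2)^-1.

End BernsteinFunctions.

Section WienerIntegral.
Context {R : realType} {d : measure_display} {T : measurableType d}.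
Variable P : probability T R.
Implicit Types (W B : R -> {RV P >-> R}) (f : R -> R) (s : seq (R * (R * R))).

Local Notation mu := (@lebesgue_measure R).

(* Taking some [A i = setT] gives the product rule for every subfamily. *)
Definition mutually_independent n (X : 'I_n -> T -> R) : Prop :=
  forall A : 'I_n -> set R, (forall i, measurable (A i)) ->
    P (\bigcap_(i in [set: 'I_n]) X i @^-1` A i) =
    (\prod_(i < n) P (X i @^-1` A i))%E.

Record two_sided_wiener W : Prop := {
  wiener0 : {ae P, forall w, W 0 w = 0} ;
  wiener_continuous : {ae P, forall w, continuous (fun u => W u w)} ;
  wiener_gaussian : forall r t, r < t ->
    forall A : set R, measurable A ->
      P ((fun w => W t w - W r w) @^-1` A) = normal_prob 0 (Num.sqrt (t - r)) A ;
  wiener_independent : forall n (t : nat -> R),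
    (forall i, (i < n)%N -> t i < t i.+1) ->
    mutually_independent (fun (i : 'I_n) w => W (t i.+1) w - W (t i) w) }.

(* The list [s] of triples [(c, (a, b))] codes the step function
   [\sum c 1_(a, b]]; triples with [b <= a] are ignored both in the function
   and in its integral. *)
Definition step_fun s (u : R) : R :=
  \sum_(p <- s | p.2.1 < p.2.2) p.1 * \1_`]p.2.1, p.2.2] u.

Definition step_int W s (w : T) : R :=
  \sum_(p <- s | p.2.1 < p.2.2) p.1 * (W p.2.2 w - W p.2.1 w).

(* [I] is a version of the Wiener integral [\int f dW]: the L^2(P)-limit of the
   integrals of some step functions converging to [f] in L^2(R).  For a
   measurable [f], such step functions exist only if [f] is in L^2(R). *)
Definition wiener_integral W f (I : {RV P >-> R}) : Prop :=
  exists s_ : nat -> seq (R * (R * R)),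
    Lnorm mu 2%:E (EFin \o (f \- step_fun (s_ n))) @[n --> \oo] --> 0%E /\
    Lnorm P 2%:E (EFin \o (I \- step_int W (s_ n))) @[n --> \oo] --> 0%E.

(* Wiener integrals are only defined up to P-null sets, hence the equality
   almost everywhere. *)
Definition B_kappa W (kappa : R -> R) B : Prop :=
  forall t : R, 0 <= t -> exists2 I : {RV P >-> R},
    wiener_integral W (ma_kernel kappa t) I &
    {ae P, forall w, B t w = Num.sqrt (norm_const kappa) * I w}.

Definition rho B (n : nat) : R :=
  fine 'E_P[fun w => B 1 w * (B n.+1%:R w - B n%:R w)].

Definition long_range_dependent B : Prop :=
  (\sum_(1 <= n <oo) `|rho B n|%:E = +oo)%E.

End WienerIntegral.

(* Main.v *)
Require Import Defs.
From HB Require Import structures.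
From mathcomp Require Import all_boot all_order all_algebra.
From mathcomp Require Import all_classical all_reals all_analysis.
From mathcomp Require Import measurable_realfun ring.

Set Implicit Arguments.
Unset Strict Implicit.
Unset Printing Implicit Defensive.

Import Order.TTheory GRing.Theory Num.Theory.
Import numFieldNormedType.Exports.

Local Open Scope classical_set_scope.
Local Open Scope ring_scope.

(** Write [K_t(u) = chi((t-u)_+) - chi((-u)_+)].  By the Wiener isometry
    [rho_n = C <K_1, K_(n+1) - K_n>], so the partial sums telescope:
    [rho_1 + ... + rho_N = C <K_1, K_(N+1) - K_1>].  The kernels are
    nonnegative and nondecreasing in [t], and for [0 < u <= 1/2] one has
    [K_1(u) >= chi(1/2) > 0] and [K_(N+1)(u) - K_1(u) >= chi(N) - chi(1)];
    hence the partial sum is at least [(C/2) chi(1/2) (chi(N) - chi(1))].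
    This is unbounded: [chi(x)] increases to the integral of [kappa], which
    dominates its Laplace transform [1/phi(theta)], and the latter tends to
    [+oo] as [theta] tends to 0.

    The isometry only uses the variances of the increments of [W]: both the
    increments [W_b - W_a] in L^2(P) and the indicators of [(a, b]] in L^2(R)
    are increments of a curve with [||X_b - X_a||^2 = |b - a|], and by
    polarization these norms determine all inner products of increments. *)

(** * Integrals over half-open intervals and against densities *)

Lemma lebesgue_measure_itvoc (R : realType) (a b : R) : a <= b ->
  lebesgue_measure (`]a, b]%classic : set R) = (b - a)%:E.
Proof.
have := @lebesgue_measure_itv R `]a, b].
rewrite /= lte_fin le_eqVlt => + /predU1P[ab|ab] => ->.
  by rewrite ab ltxx subrr.
by rewrite ab.
Qed.

Lemma integral_cst_itvoc (R : realType) (a b c : R) : a <= b ->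
  (\int[lebesgue_measure]_(x in `]a, b]) c%:E = (c * (b - a))%:E)%E.
Proof.
by move=> ab; rewrite integral_cst//= lebesgue_measure_itvoc// -EFinM.
Qed.

Lemma ge0_integral_density d (T : measurableType d) (R : realType)
    (nu : {finite_measure set T -> \bar R})
    (mu : {sigma_finite_measure set T -> \bar R}) (f g : T -> \bar R) :
  mu.-integrable setT g ->
  (forall A, measurable A -> nu A = \int[mu]_(x in A) g x)%E ->
  measurable_fun setT f -> (forall x, 0 <= f x)%E ->
  (\int[nu]_x f x = \int[mu]_x (f x * g x))%E.
Proof.
move=> ig nuE mf f0; have mg := measurable_int mu ig.
have nu_mu : nu `<< mu.
  apply/null_content_dominatesP => A mA muA; rewrite nuE//.
  by apply: null_set_integral => //; exact: measurable_funTS.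
have iRN := Radon_Nikodym_SigmaFinite.f_integrable nu_mu.
rewrite -(Radon_Nikodym_SigmaFinite.change_of_variables nu_mu)//.
apply: ae_eq_integral => //; [|exact: emeasurable_funM|].
  by apply: emeasurable_funM => //; exact: measurable_int iRN.
apply: ae_eqe_mul2l; apply: integral_ae_eq => // A _ mA.
by rewrite -Radon_Nikodym_SigmaFinite.f_integral// nuE.
Qed.

(** * The variance of the normal law *)

Lemma derivable_LRcontinuous (R : realType) (F : R -> R) (a b : R) :
  (forall x, derivable F x 1) -> derivable_oo_LRcontinuous F a b.
Proof.
move=> dF; have cF x : F y @[y --> x] --> F x.
  by apply: differentiable_continuous; exact/derivable1_diffP.
by split=> [x _ //||]; [exact: cvg_at_right_filter|exact: cvg_at_left_filter].
Qed.

Section normal_variance.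
Context {R : realType}.
Implicit Types m s r x : R.
Local Notation mu := (@lebesgue_measure R).

Lemma is_derive_normal_pdf m s x : s != 0 ->
  is_derive x 1 (normal_pdf m s) (- ((x - m) / s ^+ 2 * normal_pdf m s x)).
Proof.
move=> s0; rewrite normal_pdfE// /normal_fun.
apply: is_derive_eq; rewrite /GRing.scale/=.
by field; rewrite s0.
Qed.

Lemma normal_pdf_sym m s r : s != 0 ->
  normal_pdf m s (m - r) = normal_pdf m s (m + r).
Proof.
by move=> s0; rewrite !normal_pdfE// /normal_fun ![m + _]addrC !addrK sqrrN.
Qed.

Lemma cvgMr_normal_pdf m s : s != 0 ->
  x * normal_pdf m s (m + x) @[x --> +oo] --> 0.
Proof.
move=> s0; rewrite normal_pdfE// /normal_fun.
pose c := s ^+ 2 *+ 2; have c0 : 0 < c by rewrite pmulrn_lgt0// exprn_even_gt0.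
apply: (@squeeze_cvgr _ _ _ _ (fun=> 0) (fun x => normal_peak s * c / x)).
- near=> x.
  have x0 : 0 < x by near: x; exact: nbhs_pinfty_gt.
  rewrite mulr_ge0 ?(ltW x0) ?mulr_ge0 ?normal_peak_ge0 ?expR_ge0//=.
  have sqr_le : x ^+ 2 <= c * expR (x ^+ 2 / c).
    by rewrite mulrC -ler_pdivrMr// (le_trans _ (expR_ge1Dx _))// lerDr.
  rewrite (addrC m) addrK -/c mulrCA -mulrA ler_wpM2l ?normal_peak_ge0//.
  by rewrite mulNr expRN ler_pdivrMr ?expR_gt0// mulrAC ler_pdivlMr// -expr2.
- exact: cvg_cst.
- rewrite -(mulr0 (normal_peak s * c)); apply: cvgM; first exact: cvg_cst.
  by apply/gtr0_cvgV0; [exact: nbhs_pinfty_gt|exact: cvg_id].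
Unshelve. all: end_near. Qed.

Lemma integral_sqr_normal_pdf_itv m s r : s != 0 -> 0 < r ->
  (\int[mu]_(x in `[(m - r)%R, (m + r)%R])
     ((x - m) ^+ 2 * normal_pdf m s x)%:E =
   (- (s ^+ 2 *+ 2 * (r * normal_pdf m s (m + r))))%:E +
   (s ^+ 2)%:E *
   \int[mu]_(x in `[(m - r)%R, (m + r)%R]) (normal_pdf m s x)%:E)%E.
Proof.
move=> s0 r0; pose G x := - (s ^+ 2 * normal_pdf m s x).
pose g x := (x - m) * normal_pdf m s x.
have dG x : is_derive x 1 G (g x).
  have := is_derive_normal_pdf m x s0 => ?; rewrite /G /g.
  by apply: is_derive_eq; rewrite /GRing.scale/=; field; rewrite s0.
have dF x : is_derive x 1 (center m) 1.
  by apply: is_derive_eq; rewrite subr0.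
have cg : continuous g.
  move=> x; apply: cvgM; last exact: continuous_normal_pdf.
  by apply: cvgB; [exact: cvg_id|exact: cvg_cst].
under eq_integral => x _ do rewrite expr2 -mulrA -/(g x).
rewrite (@integration_by_parts R (center m) G (cst 1) g).
- under eq_integral do rewrite mul1r EFinN EFinM.
  rewrite integral_ge0N; last first.
    by move=> x _; rewrite mule_ge0 ?lee_fin ?sqr_ge0 ?normal_pdf_ge0.
  rewrite oppeK ge0_integralZl_EFin ?sqr_ge0//; last 2 first.
  + by move=> x _; rewrite lee_fin normal_pdf_ge0.
  + apply/measurable_EFinP/measurable_funTS; exact: measurable_normal_pdf.
  by congr (EFin _ + _)%E; rewrite /G normal_pdf_sym//=; ring.
- by rewrite ltrBlDr -addrA ltrDl addr_gt0.
- by apply: continuous_subspaceT => x; exact: cvg_cst.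
- by apply: derivable_LRcontinuous => x; have [] := dF x.
- by move=> x _; rewrite derive1E derive_val.
- exact: continuous_subspaceT.
- by apply: derivable_LRcontinuous => x; have [] := dG x.
- by move=> x _; rewrite derive1E derive_val.
Qed.

Lemma ge0_cvgn_integral_centered m (f : R -> \bar R) :
  measurable_fun setT f -> (forall x, 0 <= f x)%E ->
  (\int[mu]_(x in `[(m - n%:R)%R, (m + n%:R)%R]) f x @[n --> \oo] -->
   \int[mu]_x f x)%E.
Proof.
move=> mf f0; pose I n := `[m - n%:R, m + n%:R]%classic.
have -> : [set: R] = \bigcup_n I n.
  apply/seteqP; split=> // x _; exists (Num.trunc `|x - m|).+1 => //=.
  by rewrite /I/= in_itv/= -ler_distl ltW// -truncn_lt_nat.
apply: ge0_nondecreasing_set_cvg_integral => //.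
- move=> i j ij; rewrite subsetEset => x; rewrite /I/= !in_itv/= -!ler_distl.
  by move=> /le_trans; apply; rewrite ler_nat.
- by move=> n; exact: measurable_funTS.
Qed.

Lemma integral_sqr_normal_pdf m s : s != 0 ->
  (\int[mu]_x ((x - m) ^+ 2 * normal_pdf m s x)%:E = (s ^+ 2)%:E)%E.
Proof.
move=> s0; have mp := measurable_normal_pdf m s.
have cvg_sqr : (\int[mu]_(x in `[(m - n%:R)%R, (m + n%:R)%R])
      ((x - m) ^+ 2 * normal_pdf m s x)%:E @[n --> \oo] -->
    \int[mu]_x ((x - m) ^+ 2 * normal_pdf m s x)%:E)%E.
  apply: ge0_cvgn_integral_centered.
    apply/measurable_EFinP/measurable_funM => //.
    by apply: measurable_funX; exact: measurable_funB.
  by move=> x; rewrite lee_fin mulr_ge0 ?sqr_ge0 ?normal_pdf_ge0.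
have cvg_pdf : (\int[mu]_(x in `[(m - n%:R)%R, (m + n%:R)%R])
    (normal_pdf m s x)%:E @[n --> \oo] --> 1)%E.
  rewrite -(integral_normal_pdf m s); apply: ge0_cvgn_integral_centered.
    exact/measurable_EFinP.
  by move=> x; rewrite lee_fin normal_pdf_ge0.
have cvg_boundary :
    (- (s ^+ 2 *+ 2 * (n%:R * normal_pdf m s (m + n%:R))))%:E @[n --> \oo] -->
    0%E.
  apply: cvg_EFin; first exact: nearW.
  rewrite -oppr0 -(mulr0 (s ^+ 2 *+ 2)).
  apply: cvgN; apply: cvgM; first exact: cvg_cst.
  exact: (cvg_comp _ _ (@cvgr_idn R) (cvgMr_normal_pdf m s0)).
have cvg_scaled_pdf := cvgeZl (isT : (s ^+ 2)%:E \is a fin_num) cvg_pdf.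
have := cvgeD _ cvg_boundary cvg_scaled_pdf; rewrite mule1 add0e.
move=> /(_ _ isT) cvg_by_parts.
apply: (cvg_unique _ cvg_sqr) => //; apply: cvg_trans cvg_by_parts.
apply: near_eq_cvg; near=> n; rewrite integral_sqr_normal_pdf_itv// ltr0n.
by near: n; exact: nbhs_infty_gt.
Unshelve. all: end_near. Qed.

Lemma variance_normal_prob m s : s != 0 ->
  (\int[normal_prob m s]_x ((x - m) ^+ 2)%:E = (s ^+ 2)%:E)%E.
Proof.
move=> s0.
rewrite (@ge0_integral_density _ _ _ _ mu _ (EFin \o normal_pdf m s))//.
- by under eq_integral do rewrite -EFinM; exact: integral_sqr_normal_pdf.
- exact: integrable_normal_pdf.
- by apply/measurable_EFinP/measurable_funX; exact: measurable_funB.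
- by move=> x; rewrite lee_fin sqr_ge0.
Qed.

End normal_variance.

(** * The inner product of L^2 *)

Section dotL2.
Context {d : measure_display} {T : measurableType d} {R : realType}.
Variable m : {measure set T -> \bar R}.
Implicit Types (f g h : T -> R) (u v : nat -> T -> R).
Local Notation L2 := (Lfun m 2%:E).
Local Notation norm2 f := (Lnorm m 2%:E (EFin \o f)).

Definition dotL2 f g : R := \int[m]_x (f x * g x).

Lemma Lfun_measurable p f : f \in Lfun m p -> measurable_fun setT f.
Proof. by move=> /sub_Lfun_mfun; rewrite inE. Qed.

Lemma Lfun_norm_lty p f : f \in Lfun m p -> (Lnorm m p (EFin \o f) < +oo)%E.
Proof. by move=> /sub_Lfun_finLfun; rewrite inE. Qed.

Lemma Lfun2P f : f \in L2 <->
  measurable_fun setT f /\ (\int[m]_x (f x ^+ 2)%:E < +oo)%E.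
Proof.
have norm2E : norm2 f = ((\int[m]_x (f x ^+ 2)%:E) `^ 2^-1)%E.
  rewrite unlock; congr (_ `^ _)%E; apply: eq_integral => x _ /=.
  by rewrite powR_mulrn// real_normK// num_real.
split=> [f2|[mf f2]]; last first.
  by rewrite inE; apply/andP; rewrite !inE/= /finite_norm norm2E poweR_lty.
split; first exact: Lfun_measurable f2.
have /integrableP[_] := Lfun2_integrable_sqr f2.
by under eq_integral do rewrite gee0_abs ?lee_fin ?sqr_ge0//.
Qed.

Lemma Lfun2B f g : f \in L2 -> g \in L2 -> f - g \in L2.
Proof. by move=> f2 g2; rewrite rpredB ?lee1n. Qed.

Lemma Lfun2M_integrable f g : f \in L2 -> g \in L2 ->
  m.-integrable setT (EFin \o (fun x => f x * g x)).
Proof. by move=> f2 g2; apply/Lfun1_integrable; exact: Lfun2_mul_Lfun1. Qed.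

Lemma integral_sqr_dotL2 f : f \in L2 ->
  (\int[m]_x (f x ^+ 2)%:E = (dotL2 f f)%:E)%E.
Proof.
move=> f2; rewrite /dotL2 /Rintegral fineK; last first.
  by apply: integrable_fin_num => //; exact: Lfun2M_integrable.
by apply: eq_integral => x _; rewrite expr2.
Qed.

Lemma dotL2C f g : dotL2 f g = dotL2 g f.
Proof. by apply: eq_Rintegral => x _; rewrite mulrC. Qed.

Lemma dotL2Dl f g h : f \in L2 -> g \in L2 -> h \in L2 ->
  dotL2 (f + g) h = dotL2 f h + dotL2 g h.
Proof.
move=> f2 g2 h2; rewrite -RintegralD//; [|exact: Lfun2M_integrable..].
by apply: eq_Rintegral => x _; rewrite -mulrDl.
Qed.

Lemma dotL2Zl c f h : f \in L2 -> h \in L2 ->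
  dotL2 (c *: f) h = c * dotL2 f h.
Proof.
move=> f2 h2; rewrite -RintegralZl//; last exact: Lfun2M_integrable.
by apply: eq_Rintegral => x _; rewrite mulrA.
Qed.

Lemma dotL2Zr c f h : f \in L2 -> h \in L2 ->
  dotL2 h (c *: f) = c * dotL2 h f.
Proof. by move=> f2 h2; rewrite dotL2C dotL2Zl// dotL2C. Qed.

Lemma dotL2Bl f g h : f \in L2 -> g \in L2 -> h \in L2 ->
  dotL2 (f - g) h = dotL2 f h - dotL2 g h.
Proof.
move=> f2 g2 h2; rewrite -[- g]scaleN1r dotL2Dl ?dotL2Zl ?mulN1r//.
by rewrite rpredZ ?lee1n.
Qed.

Lemma dotL2Br f g h : f \in L2 -> g \in L2 -> h \in L2 ->
  dotL2 h (f - g) = dotL2 h f - dotL2 h g.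
Proof. by move=> f2 g2 h2; rewrite dotL2C dotL2Bl// !(dotL2C h). Qed.

Lemma dotL2_suml (I : Type) (s : seq I) (Q : pred I) (F : I -> T -> R) h :
  (forall i, Q i -> F i \in L2) -> h \in L2 ->
  dotL2 (\sum_(i <- s | Q i) F i) h = \sum_(i <- s | Q i) dotL2 (F i) h.
Proof.
move=> F2 h2; elim: s => [|i s ih].
  by rewrite !big_nil -(scale0r h) dotL2Zl// mul0r.
rewrite !big_cons; case: (boolP (Q i)) => // Qi.
by rewrite dotL2Dl ?ih ?F2// rpred_sum ?lee1n.
Qed.

Lemma dotL2_sumr (I : Type) (s : seq I) (Q : pred I) (F : I -> T -> R) h :
  (forall i, Q i -> F i \in L2) -> h \in L2 ->
  dotL2 h (\sum_(i <- s | Q i) F i) = \sum_(i <- s | Q i) dotL2 h (F i).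
Proof.
move=> F2 h2; rewrite dotL2C dotL2_suml//.
by apply: eq_bigr => i _; rewrite dotL2C.
Qed.

Lemma dotL2_polarization f g : f \in L2 -> g \in L2 ->
  dotL2 f g = (dotL2 f f + dotL2 g g - dotL2 (f - g) (f - g)) / 2.
Proof.
move=> f2 g2; have fg2 := Lfun2B f2 g2.
by rewrite dotL2Bl// !dotL2Br// (dotL2C g f); field.
Qed.

Lemma ae_eq_Lfun2 f g : measurable_fun setT f ->
  {ae m, forall x, f x = g x} -> g \in L2 -> f \in L2.
Proof.
move=> mf fg /Lfun2P[mg g2]; apply/Lfun2P; split=> //.
rewrite (_ : (\int[m]_x _ = \int[m]_x (g x ^+ 2)%:E)%E)//.
apply: ae_eq_integral => //; last by apply: filterS fg => x /= ->.
- by apply/measurable_EFinP; exact: measurable_funX.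
- by apply/measurable_EFinP; exact: measurable_funX.
Qed.

Lemma ae_eq_dotL2 f f' g g' :
  measurable_fun setT f -> measurable_fun setT f' ->
  measurable_fun setT g -> measurable_fun setT g' ->
  {ae m, forall x, f x = f' x} -> {ae m, forall x, g x = g' x} ->
  dotL2 f g = dotL2 f' g'.
Proof.
move=> mf mf' mg mg' ff' gg'; congr fine; apply: ae_eq_integral => //.
- by apply/measurable_EFinP; exact: measurable_funM.
- by apply/measurable_EFinP; exact: measurable_funM.
- by move: ff' gg'; apply: filterS2 => x /= -> ->.
Qed.

Lemma dotL2_ge (A : set T) f g (a b : R) :
  measurable A -> f \in L2 -> g \in L2 ->
  (forall x, 0 <= f x) -> (forall x, 0 <= g x) -> 0 <= a -> 0 <= b ->
  (forall x, A x -> a <= f x) -> (forall x, A x -> b <= g x) ->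
  ((a * b)%:E * m A <= (dotL2 f g)%:E)%E.
Proof.
move=> mA f2 g2 f0 g0 a0 b0 af bg; have ifg := Lfun2M_integrable f2 g2.
have mfg := measurable_int m ifg.
have fg0 x : (0 <= (f x * g x)%:E)%E by rewrite lee_fin mulr_ge0.
rewrite /dotL2 /Rintegral fineK; last exact: integrable_fin_num.
rewrite -integral_cst//.
apply: (@le_trans _ _ (\int[m]_(x in A) (f x * g x)%:E)%E).
- apply: ge0_le_integral => //.
  + by move=> x _; rewrite lee_fin mulr_ge0.
  + exact: measurable_funTS.
  + by move=> x Ax; rewrite lee_fin ler_pM ?af ?bg.
- exact: ge0_subset_integral.
Qed.

Lemma cauchy_schwarz_dotL2 f g : f \in L2 -> g \in L2 ->
  (`|dotL2 f g|%:E <= norm2 f * norm2 g)%E.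
Proof.
move=> f2 g2; have ifg := Lfun2M_integrable f2 g2.
rewrite EFin_normr_Rintegral//.
apply: le_trans (le_abse_integral _ measurableT (measurable_int m ifg)) _.
have <- := Lnorm1 m (EFin \o (f \* g)).
apply: hoelder => //; [exact: Lfun_measurable f2|exact: Lfun_measurable g2|].
by rewrite [RHS]splitr !div1r.
Qed.

Lemma cvg_dotL2_0 u v (l : R) :
  (forall n, u n \in L2) -> (forall n, v n \in L2) ->
  norm2 (u n) @[n --> \oo] --> 0%E -> norm2 (v n) @[n --> \oo] --> l%:E ->
  dotL2 (u n) (v n) @[n --> \oo] --> 0.
Proof.
move=> u2 v2 u0 vl; apply: norm_cvg0.
suff /fine_cvgP[] : (`|dotL2 (u n) (v n)|%:E @[n --> \oo] --> 0%:E)%E by [].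
apply: (@squeeze_cvge _ _ _ _ (cst 0%E) _
  (fun n => norm2 (u n) * norm2 (v n))%E).
- by apply: nearW => n; rewrite lee_fin normr_ge0/= cauchy_schwarz_dotL2.
- exact: cvg_cst.
- by have := cvgeM _ u0 vl; rewrite mul0e; apply.
Qed.

Lemma Lfun_cvg p f u : (1 <= p)%E -> measurable_fun setT f ->
  (forall n, u n \in Lfun m p) ->
  Lnorm m p (EFin \o (f \- u n)) @[n --> \oo] --> 0%E -> f \in Lfun m p.
Proof.
move=> p1 mf up /fine_cvgP[/filter_ex[n fu_fin] _].
have -> : f = (f - u n) + u n by rewrite subrK.
rewrite rpredD// inE; apply/andP; rewrite !inE/=; split.
  by apply: measurable_funB => //; exact: Lfun_measurable (up n).
by rewrite /finite_norm ltey_eq fu_fin.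
Qed.

Lemma cvg_dotL2 f g u v :
  measurable_fun setT f -> measurable_fun setT g ->
  (forall n, u n \in L2) -> (forall n, v n \in L2) ->
  norm2 (f \- u n) @[n --> \oo] --> 0%E ->
  norm2 (g \- v n) @[n --> \oo] --> 0%E ->
  dotL2 (u n) (v n) @[n --> \oo] --> dotL2 f g.
Proof.
move=> mf mg u2 v2 fu gv.
have f2 := Lfun_cvg (lee1n 2) mf u2 fu; have g2 := Lfun_cvg (lee1n 2) mg v2 gv.
have fu2 n : f - u n \in L2 by exact: Lfun2B.
have gv2 n : g - v n \in L2 by exact: Lfun2B.
have norm_fin h : h \in L2 -> norm2 h \is a fin_num.
  by move=> h2; rewrite ge0_fin_numE ?Lnorm_ge0// Lfun_norm_lty.
have fuv n : dotL2 (u n) (v n) = dotL2 f g - dotL2 (f - u n) g -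
    (dotL2 (g - v n) f - dotL2 (f - u n) (g - v n)).
  by rewrite !(dotL2Bl, dotL2Br)// (dotL2C g f) (dotL2C _ f); ring.
suff : dotL2 f g - dotL2 (f - u n) g -
    (dotL2 (g - v n) f - dotL2 (f - u n) (g - v n)) @[n --> \oo] -->
    dotL2 f g - 0 - (0 - 0).
  by rewrite !subr0; under eq_fun do rewrite -fuv.
apply: cvgB; apply: cvgB; first exact: cvg_cst.
- apply: (@cvg_dotL2_0 _ _ (fine (norm2 g))) => //.
  by rewrite fineK ?norm_fin//; exact: cvg_cst.
- apply: (@cvg_dotL2_0 _ _ (fine (norm2 f))) => //.
  by rewrite fineK ?norm_fin//; exact: cvg_cst.
- exact: (@cvg_dotL2_0 _ _ 0).
Qed.

End dotL2.

(** * Wiener integrals *)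

Section wiener_spiral.
Context {R : realType}.
Implicit Types (a b : R) (s t : seq (R * (R * R))).

(* Kolmogorov's Wienersche Spirale. *)
Definition wiener_spiral d (T : measurableType d)
    (m : {measure set T -> \bar R}) (X : R -> T -> R) : Prop :=
  (forall a, measurable_fun setT (X a)) /\
  (forall a b, a < b -> (\int[m]_x ((X b x - X a x) ^+ 2)%:E = (b - a)%:E)%E).

Definition step_increment (T : Type) (X : R -> T -> R) s : T -> R :=
  \sum_(p <- s | p.2.1 < p.2.2) p.1 *: (X p.2.2 - X p.2.1).

Section inner_products.
Context {d : measure_display} {T : measurableType d}.
Variables (m : {measure set T -> \bar R}) (X : R -> T -> R).
Hypothesis spiralX : wiener_spiral m X.

Lemma integral_sqr_increment a b :
  (\int[m]_x ((X b x - X a x) ^+ 2)%:E = `|b - a|%:E)%E.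
Proof.
have [_ sqrX] := spiralX; have [ab|ba|->] := ltgtP a b.
- by rewrite sqrX// gtr0_norm// subr_gt0.
- rewrite distrC gtr0_norm ?subr_gt0// -sqrX//.
  by apply: eq_integral => x _; rewrite -opprB sqrrN.
- under eq_integral do rewrite subrr expr0n/=.
  by rewrite integral0 subrr normr0.
Qed.

Lemma increment_Lfun2 a b : X b - X a \in Lfun m 2%:E.
Proof.
have [mX _] := spiralX; apply/Lfun2P; split; first exact: measurable_funB.
by rewrite integral_sqr_increment ltry.
Qed.

Lemma dotL2_increment a b : dotL2 m (X b - X a) (X b - X a) = `|b - a|.
Proof.
apply: EFin_inj; rewrite -integral_sqr_dotL2; last exact: increment_Lfun2.
exact: integral_sqr_increment.
Qed.

Lemma dotL2_increments a b a' b' :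
  dotL2 m (X b - X a) (X b' - X a') =
  (`|b - a'| + `|a - b'| - `|b - b'| - `|a - a'|) / 2.
Proof.
pose Y c := X c - X 0.
have Y2 c : Y c \in Lfun m 2%:E by exact: increment_Lfun2.
have XY c c' : X c - X c' = Y c - Y c' by rewrite /Y opprB addrA subrK.
have dotY c c' : dotL2 m (Y c) (Y c') =
    (dotL2 m (Y c) (Y c) + dotL2 m (Y c') (Y c') - `|c - c'|) / 2.
  by rewrite dotL2_polarization// -dotL2_increment XY.
have YB2 c c' : Y c - Y c' \in Lfun m 2%:E by exact: Lfun2B.
clearbody Y; rewrite !XY dotL2Bl// !dotL2Br//.
by rewrite (dotY b b') (dotY b a') (dotY a b') (dotY a a'); field.
Qed.

Lemma step_increment_Lfun2 s : step_increment X s \in Lfun m 2%:E.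
Proof.
apply: rpred_sum => [|? p _]; first exact: lee1n.
by rewrite rpredZ ?lee1n//; exact: increment_Lfun2.
Qed.

Lemma dotL2_step_incrementE s t :
  dotL2 m (step_increment X s) (step_increment X t) =
  \sum_(p <- s | p.2.1 < p.2.2) \sum_(q <- t | q.2.1 < q.2.2)
    p.1 * (q.1 * dotL2 m (X p.2.2 - X p.2.1) (X q.2.2 - X q.2.1)).
Proof.
have X2 (p : R * (R * R)) := increment_Lfun2 p.2.1 p.2.2.
have cX2 (p : R * (R * R)) : p.1 *: (X p.2.2 - X p.2.1) \in Lfun m 2%:E.
  by rewrite rpredZ ?lee1n.
have t2 := step_increment_Lfun2 t.
rewrite dotL2_suml//; apply: eq_bigr => p _.
rewrite dotL2Zl// dotL2_sumr// mulr_sumr; apply: eq_bigr => q _.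
by rewrite dotL2Zr.
Qed.

End inner_products.

Lemma dotL2_step_increment d (T : measurableType d) d' (T' : measurableType d')
    (m : {measure set T -> \bar R}) (m' : {measure set T' -> \bar R})
    (X : R -> T -> R) (Y : R -> T' -> R) s t :
  wiener_spiral m X -> wiener_spiral m' Y ->
  dotL2 m (step_increment X s) (step_increment X t) =
  dotL2 m' (step_increment Y s) (step_increment Y t).
Proof.
move=> sX sY; rewrite (dotL2_step_incrementE sX) (dotL2_step_incrementE sY).
apply: eq_bigr => p _; apply: eq_bigr => q _.
by rewrite (dotL2_increments sX) (dotL2_increments sY).
Qed.

Definition halfline_indic a : R -> R := \1_`]-oo, a].

Lemma halfline_indicB a b : a < b ->
  halfline_indic b - halfline_indic a = \1_`]a, b].
Proof.
move=> ab; apply/funext => x; rewrite /halfline_indic !fctE !indicE !mem_setE.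
rewrite !in_itv/=; have [xa|ax] := leP x a; last by rewrite subr0.
by rewrite (le_trans xa (ltW ab)) subrr.
Qed.

Lemma wiener_spiral_halfline : wiener_spiral lebesgue_measure halfline_indic.
Proof.
split=> [a|a b ab]; first exact: measurable_indic.
transitivity (\int[lebesgue_measure]_x (\1_`]a, b] x : R)%:E)%E.
  apply: eq_integral => x _.
  rewrite -[X in X ^+ 2]/((halfline_indic b - halfline_indic a) x).
  by rewrite halfline_indicB// indicE; case: (_ \in _); rewrite ?expr1n ?expr0n.
by rewrite integral_indic//= setIT lebesgue_measure_itvoc// ltW.
Qed.

Lemma step_funE s : step_fun s = step_increment halfline_indic s.
Proof.
rewrite /step_increment fct_sumE; apply/funext => x; apply: eq_bigr => p ab.
by rewrite halfline_indicB.
Qed.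

Section wiener_integral.
Context {d : measure_display} {T : measurableType d}.
Variables (P : probability T R) (W : R -> {RV P >-> R}).
Hypothesis W_wiener : two_sided_wiener W.
Implicit Types (f g : R -> R) (I J : {RV P >-> R}).
Local Notation mu := (@lebesgue_measure R).

Lemma wiener_spiral_wiener : wiener_spiral P W.
Proof.
split=> // a b ab; have ba : 0 < b - a by rewrite subr_gt0.
pose X (w : T) : measurableTypeR R := W b w - W a w.
have mX : measurable_fun setT X by exact: measurable_funB.
have msqr : measurable_fun setT (fun x : measurableTypeR R => (x ^+ 2)%:E).
  by apply/measurable_EFinP; exact: measurable_funX.
have EFin_sqr_ge0 (x : R) : (0 <= (x ^+ 2)%:E)%E by rewrite lee_fin sqr_ge0.
have := ge0_integral_pushforward mX P measurableT msqr
  (fun x _ => EFin_sqr_ge0 x).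
rewrite preimage_setT => <-.
rewrite (@eq_measure_integral _ _ _ _ (normal_prob 0 (Num.sqrt (b - a)))).
  under eq_integral do rewrite -[x in x ^+ 2]subr0.
  by rewrite variance_normal_prob ?sqr_sqrtr ?ltW// gt_eqF// sqrtr_gt0.
by move=> A mA _; exact: wiener_gaussian.
Qed.

Lemma step_intE s : step_int W s = step_increment W s.
Proof. by rewrite /step_increment fct_sumE. Qed.

Lemma step_fun_Lfun2 s : step_fun s \in Lfun mu 2%:E.
Proof.
by rewrite step_funE; exact: step_increment_Lfun2 wiener_spiral_halfline _.
Qed.

Lemma step_int_Lfun2 s : step_int W s \in Lfun P 2%:E.
Proof.
by rewrite step_intE; exact: step_increment_Lfun2 wiener_spiral_wiener _.
Qed.

Lemma dotL2_step_int s t :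
  dotL2 P (step_int W s) (step_int W t) = dotL2 mu (step_fun s) (step_fun t).
Proof.
rewrite !step_intE !step_funE; apply: dotL2_step_increment.
  exact: wiener_spiral_wiener.
exact: wiener_spiral_halfline.
Qed.

Lemma wiener_integral_Lfun2 f I : measurable_fun setT f ->
  wiener_integral W f I -> f \in Lfun mu 2%:E /\ (I : T -> R) \in Lfun P 2%:E.
Proof.
move=> mf [s_ [fs Is]]; split.
  by apply: (Lfun_cvg (m := mu) (lee1n 2) mf _ fs) => n; exact: step_fun_Lfun2.
by apply: (Lfun_cvg (lee1n 2) _ _ Is) => // n; exact: step_int_Lfun2.
Qed.

Lemma dotL2_wiener_integral f g I J :
  measurable_fun setT f -> measurable_fun setT g ->
  wiener_integral W f I -> wiener_integral W g J ->
  dotL2 P I J = dotL2 mu f g.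
Proof.
move=> mf mg [s_ [fs Is]] [t_ [gt Jt]].
have cvg_int : dotL2 P (step_int W (s_ n)) (step_int W (t_ n)) @[n --> \oo] -->
    dotL2 P I J.
  by apply: cvg_dotL2 => // n; exact: step_int_Lfun2.
have cvg_fun : dotL2 P (step_int W (s_ n)) (step_int W (t_ n)) @[n --> \oo] -->
    dotL2 mu f g.
  under eq_fun do rewrite dotL2_step_int.
  by apply: cvg_dotL2 => // n; exact: step_fun_Lfun2.
exact: cvg_unique cvg_int cvg_fun.
Qed.

End wiener_integral.
End wiener_spiral.

(** * Moving averages *)

Section moving_average_kernel.
Context {R : realType}.
Variable kappa : R -> R.
Implicit Types h s t u x y : R.
Local Notation mu := (@lebesgue_measure R).
Local Notation K := (ma_kernel kappa).
Hypothesis kappa_ge0 : forall x, 0 < x -> 0 <= kappa x.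
Hypothesis kappa_integrable : forall x, mu.-integrable `]0, x] (EFin \o kappa).
Hypothesis kappa_noninc : forall x y, 0 < x -> x <= y -> kappa y <= kappa x.
Hypothesis kappa_infinite : (\int[mu]_(x in `]0%R, +oo[) (kappa x)%:E = +oo)%E.

Lemma EFin_chi x :
  ((chi kappa x)%:E = \int[mu]_(z in `]0%R, x]) (kappa z)%:E)%E.
Proof. by rewrite /chi /Rintegral fineK// integrable_fin_num. Qed.

Lemma chi_le0 x : x <= 0 -> chi kappa x = 0.
Proof.
by move=> x0; rewrite /chi set_itv_ge ?Rintegral_set0// bnd_simp -leNgt.
Qed.

Lemma chiB x y : 0 <= x -> x <= y ->
  chi kappa y - chi kappa x = \int[mu]_(z in `]x, y]) kappa z.
Proof. by move=> x0 xy; rewrite Rintegral_itvB ?bnd_simp. Qed.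

Lemma le_chi : {homo chi kappa : x y / x <= y}.
Proof.
move=> x y xy; rewrite -lee_fin !EFin_chi; apply: ge0_subset_integral => //.
- exact: measurable_int (kappa_integrable y).
- by move=> z /=; rewrite in_itv/= => /andP[z0 _]; rewrite lee_fin kappa_ge0.
- by apply: subset_itvl; rewrite bnd_simp.
Qed.

Lemma cvgy_chi : chi kappa n%:R @[n --> \oo] --> +oo.
Proof.
have itvE : `]0, +oo[%classic = \bigcup_n `]0, n%:R]%classic :> set R.
  by rewrite itv_bndy_bigcup_BRight; apply: eq_bigcupr => n _; rewrite add0r.
apply/cvgeryP; rewrite -kappa_infinite itvE.
under eq_fun => n do rewrite EFin_chi.
apply: ge0_nondecreasing_set_cvg_integral => //.
- move=> i j ij; rewrite subsetEset; apply: subset_itvl.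
  by rewrite bnd_simp ler_nat.
- by move=> n; exact: measurable_int (kappa_integrable n%:R).
- by move=> n x /=; rewrite in_itv/= => /andP[x0 _]; rewrite lee_fin kappa_ge0.
Qed.

Lemma chi_ge x : 0 < x -> kappa x * x <= chi kappa x.
Proof.
move=> x0; rewrite -[X in _ * X]subr0 -lee_fin -(integral_cst_itvoc _ (ltW x0)).
rewrite EFin_chi; apply: ge0_le_integral => //.
- by move=> z _; rewrite lee_fin kappa_ge0.
- exact: measurable_int (kappa_integrable x).
- move=> z /=; rewrite in_itv/= => /andP[z0 zx].
  by rewrite lee_fin kappa_noninc.
Qed.

Lemma chiB_le x y : 0 < x -> x <= y ->
  chi kappa y - chi kappa x <= kappa x * (y - x).
Proof.
move=> x0 xy; have i_xy : mu.-integrable `]x, y] (EFin \o kappa).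
  apply: integrableS (kappa_integrable y) => //.
  by apply: subset_itvr; rewrite bnd_simp ltW.
rewrite chiB ?(ltW x0)// -lee_fin -integral_cst_itvoc//.
rewrite /Rintegral fineK; last exact: integrable_fin_num.
apply: ge0_le_integral => //.
- move=> z /=; rewrite in_itv/= => /andP[xz _].
  by rewrite lee_fin kappa_ge0// (lt_trans x0).
- exact: measurable_int i_xy.
- move=> z /=; rewrite in_itv/= => /andP[/ltW xz _].
  by rewrite lee_fin kappa_noninc.
Qed.

Lemma chi_gt0 x : 0 < x -> 0 < chi kappa x.
Proof.
move=> x0; apply: lt_le_trans (chi_ge x0).
have /cvgryPgt/(_ (chi kappa x))/filter_ex[n chi_lt] := cvgy_chi.
have xn : x < n%:R.
  by rewrite ltNge; apply: contraL chi_lt => nx; rewrite -leNgt le_chi.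
have : 0 < kappa x * (n%:R - x).
  by rewrite (lt_le_trans _ (chiB_le x0 (ltW xn)))// subr_gt0.
by rewrite pmulr_lgt0 ?subr_gt0// => kappa_x0; rewrite mulr_gt0.
Qed.

Lemma ma_kernel0 u : K 0 u = 0.
Proof. by rewrite /ma_kernel sub0r subrr. Qed.

Lemma le_ma_kernel u : {homo K^~ u : s t / s <= t}.
Proof.
by move=> s t st; rewrite lerB// le_chi// ge_max !le_max lexx orbT lerB.
Qed.

Lemma ma_kernel_ge0 t u : 0 <= t -> 0 <= K t u.
Proof. by move=> t0; rewrite -(ma_kernel0 u) le_ma_kernel. Qed.

Lemma ma_kernel_chi t u : 0 <= u -> u <= t -> K t u = chi kappa (t - u).
Proof.
move=> u0 ut; rewrite /ma_kernel (max_idPl _) ?subr_ge0//.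
by rewrite (max_idPr _) ?oppr_le0// [X in _ - X]chi_le0 ?subr0.
Qed.

Lemma measurable_ma_kernel t : measurable_fun setT (K t).
Proof.
apply: measurable_funB; apply: nonincreasing_measurable => // u v uv;
  by rewrite le_chi// ge_max !le_max lexx orbT ?lerD2l lerN2 uv.
Qed.

Lemma dotL2_ma_kernel_ge h s (g : R -> R) (c : R) : 0 < h -> h <= s -> 0 <= c ->
  K s \in Lfun mu 2%:E -> g \in Lfun mu 2%:E ->
  (forall u, 0 <= g u) -> (forall u, 0 < u -> u <= h -> c <= g u) ->
  chi kappa (s - h) * c * h <= dotL2 mu (K s) g.
Proof.
move=> h0 hs c0 Ks2 g2 g0 gc; have s0 : 0 <= s by rewrite (le_trans (ltW h0)).
have : ((chi kappa (s - h) * c)%:E * mu `]0%R, h] <=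
    (dotL2 mu (K s) g)%:E)%E.
  apply: dotL2_ge => //.
  - by move=> u; exact: ma_kernel_ge0.
  - by rewrite -(chi_le0 (lexx 0)) le_chi// subr_ge0.
  - move=> u /=; rewrite in_itv/= => /andP[u0 uh].
    by rewrite ma_kernel_chi ?(ltW u0) ?(le_trans uh)// le_chi// lerD2l lerN2.
  - by move=> u /=; rewrite in_itv/= => /andP[]; exact: gc.
by rewrite lebesgue_measure_itvoc ?(ltW h0)// subr0 -EFinM lee_fin.
Qed.

Lemma dotL2_ma_kernel_increment_ge h s t : 0 < h -> h <= s -> s + h <= t ->
  K s \in Lfun mu 2%:E -> K t \in Lfun mu 2%:E ->
  chi kappa (s - h) * (chi kappa (t - h) - chi kappa s) * h <=
  dotL2 mu (K s) (K t - K s).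
Proof.
move=> h0 hs sht Ks2 Kt2.
have st : s <= t by rewrite (le_trans _ sht)// lerDl ltW.
apply: (dotL2_ma_kernel_ge h0 hs _ Ks2 (Lfun2B Kt2 Ks2)).
- by rewrite subr_ge0 le_chi// lerBrDr.
- by move=> u; rewrite subr_ge0 le_ma_kernel.
- move=> u u0 uh; rewrite -[leRHS]/(K t u - K s u).
  rewrite !ma_kernel_chi ?(ltW u0) ?(le_trans uh) ?(le_trans hs)//.
  by rewrite lerB// le_chi// ?lerD2l ?lerN2// gerBl ltW.
Qed.

Lemma dotL2_ma_kernel_gt0 s : 0 < s -> K s \in Lfun mu 2%:E ->
  0 < dotL2 mu (K s) (K s).
Proof.
move=> s0 Ks2; have s20 : 0 < s / 2 by rewrite divr_gt0.
have s_half : s - s / 2 = s / 2 by rewrite [X in X - _]splitr addrK.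
have chi_s2 := chi_gt0 s20.
apply: (@lt_le_trans _ _ (chi kappa (s - s / 2) * chi kappa (s / 2) * (s / 2))).
  by rewrite s_half !mulr_gt0.
apply: dotL2_ma_kernel_ge; rewrite ?(ltW chi_s2)//.
- by rewrite -subr_ge0 s_half ltW.
- by move=> u; rewrite ma_kernel_ge0 ?ltW.
- move=> u u0 us; rewrite -s_half ma_kernel_chi ?(ltW u0)//.
    by rewrite le_chi// lerD2l lerN2.
  by rewrite (le_trans us)// -subr_ge0 s_half ltW.
Qed.

Section moving_average_process.
Context {d : measure_display} {T : measurableType d}.
Variables (P : probability T R) (W B : R -> {RV P >-> R}).
Hypothesis W_wiener : two_sided_wiener W.
Hypothesis B_def : B_kappa W kappa B.

Lemma ma_kernel_Lfun2 t : 0 <= t -> K t \in Lfun mu 2%:E.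
Proof.
move=> t0; have [I KI _] := B_def t0.
by have [] := wiener_integral_Lfun2 W_wiener (measurable_ma_kernel t) KI.
Qed.

Lemma norm_constE : norm_const kappa = (dotL2 mu (K 1) (K 1))^-1.
Proof. by congr (_^-1); apply: eq_Rintegral => u _; rewrite expr2. Qed.

Lemma norm_const_ge0 : 0 <= norm_const kappa.
Proof. by rewrite invr_ge0 Rintegral_ge0// => u _; rewrite sqr_ge0. Qed.

Lemma B_kappa_Lfun2 t : 0 <= t -> (B t : T -> R) \in Lfun P 2%:E.
Proof.
move=> t0; have [I KI BI] := B_def t0.
have [_ I2] := wiener_integral_Lfun2 W_wiener (measurable_ma_kernel t) KI.
have cI2 : Num.sqrt (norm_const kappa) *: (I : T -> R) \in Lfun P 2%:E.
  by rewrite rpredZ ?lee1n.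
exact: ae_eq_Lfun2 (measurable_funPT _) BI cI2.
Qed.

Lemma dotL2_B_kappa s t : 0 <= s -> 0 <= t ->
  dotL2 P (B s) (B t) = norm_const kappa * dotL2 mu (K s) (K t).
Proof.
move=> s0 t0; have [I KI BI] := B_def s0; have [J KJ BJ] := B_def t0.
have [_ I2] := wiener_integral_Lfun2 W_wiener (measurable_ma_kernel s) KI.
have [_ J2] := wiener_integral_Lfun2 W_wiener (measurable_ma_kernel t) KJ.
pose c := Num.sqrt (norm_const kappa).
have -> : dotL2 P (B s) (B t) = dotL2 P (c *: (I : T -> R)) (c *: (J : T -> R)).
  by apply: ae_eq_dotL2 => //; exact: measurable_funM.
have cJ2 : c *: (J : T -> R) \in Lfun P 2%:E by rewrite rpredZ ?lee1n.
rewrite dotL2Zl// dotL2Zr// mulrA -expr2 sqr_sqrtr ?norm_const_ge0//.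
have [mKs mKt] := (measurable_ma_kernel s, measurable_ma_kernel t).
by rewrite (dotL2_wiener_integral W_wiener mKs mKt KI KJ).
Qed.

Lemma rhoE n :
  rho B n = norm_const kappa *
            (dotL2 mu (K 1) (K n.+1%:R) - dotL2 mu (K 1) (K n%:R)).
Proof.
have -> : rho B n = dotL2 P (B 1) ((B n.+1%:R : T -> R) - (B n%:R : T -> R)).
  by rewrite /rho unlock.
by rewrite dotL2Br ?B_kappa_Lfun2// !dotL2_B_kappa// mulrBr.
Qed.

Lemma sum_rho N : \sum_(1 <= n < N.+1) rho B n =
  norm_const kappa * dotL2 mu (K 1) (K N.+1%:R - K 1).
Proof.
under eq_bigr do rewrite rhoE.
by rewrite -mulr_sumr telescope_sumr// [in RHS]dotL2Br//;
  exact: ma_kernel_Lfun2.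
Qed.

Lemma norm_const_gt0 : 0 < norm_const kappa.
Proof.
rewrite norm_constE invr_gt0.
by apply: dotL2_ma_kernel_gt0 => //; exact: ma_kernel_Lfun2.
Qed.

Lemma sum_rho_ge N : (0 < N)%N ->
  norm_const kappa * (chi kappa 2^-1 / 2) * (chi kappa N%:R - chi kappa 1) <=
  \sum_(1 <= n < N.+1) rho B n.
Proof.
move=> N0; rewrite sum_rho -mulrA ler_pM2l ?norm_const_gt0//.
have half0 : 0 < 2^-1 :> R by rewrite invr_gt0.
have half1 : 1 - 2^-1 = 2^-1 :> R by rewrite [X in X - _]splitr div1r addrK.
have half_le1 : 2^-1 <= 1 :> R by rewrite -subr_ge0 half1 ltW.
have N_ge : 1 + 2^-1 <= N.+1%:R :> R.
  by rewrite -(natr1 N) addrC lerD2r (le_trans half_le1)// ler1n.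
have := dotL2_ma_kernel_increment_ge half0 half_le1 N_ge
  (ma_kernel_Lfun2 ler01) (ma_kernel_Lfun2 (ler0n R N.+1)).
rewrite half1 mulrAC; apply: le_trans; rewrite ler_wpM2l//.
  by rewrite divr_ge0// ltW// chi_gt0.
by rewrite lerB// le_chi// -(natr1 N) -addrA lerDl half1 ltW.
Qed.

Lemma long_range_dependent_B_kappa : long_range_dependent B.
Proof.
pose c := norm_const kappa * (chi kappa 2^-1 / 2).
have c0 : 0 < c.
  by rewrite !mulr_gt0 ?norm_const_gt0 ?chi_gt0 ?invr_gt0.
apply: eq_infty => M; near \oo => N.
have N0 : (0 < N)%N by near: N; exact: nbhs_infty_gt.
apply: (@le_trans _ _ (\sum_(1 <= n < N.+1) `|rho B n|%:E)%E); last first.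
  exact: nneseries_lim_ge.
rewrite sumEFin lee_fin.
apply: (@le_trans _ _ (\sum_(1 <= n < N.+1) rho B n)); last first.
  by apply: ler_sum => n _; exact: ler_norm.
apply: le_trans (sum_rho_ge N0); rewrite -/c mulrC -ler_pdivrMr// lerBrDr.
by near: N; move/cvgryPge : cvgy_chi; exact.
Unshelve. all: end_near. Qed.

End moving_average_process.
End moving_average_kernel.

Lemma laplace_le_integral (R : realType) (kappa : R -> R) (theta : R) :
  (forall x, 0 < x -> 0 <= kappa x) ->
  measurable_fun (`]0, +oo[ : set R) kappa -> 0 < theta ->
  (laplace kappa theta <=
   \int[lebesgue_measure]_(x in `]0%R, +oo[) (kappa x)%:E)%E.
Proof.
move=> kappa_ge0 mkappa theta0; apply: ge0_le_integral => //=.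
- move=> x; rewrite in_itv/= andbT => x0.
  by rewrite lee_fin mulr_ge0 ?expR_ge0 ?kappa_ge0.
- apply/measurable_EFinP; apply: measurable_funM => //.
  apply: measurable_funTS; apply: measurableT_comp => //.
  by apply: measurableT_comp => //; exact: measurable_funM.
- exact/measurable_EFinP.
- move=> x; rewrite in_itv/= andbT => x0; rewrite lee_fin ler_piMl ?kappa_ge0//.
  by rewrite -expR0 ler_expR oppr_le0 mulr_ge0// ltW.
Qed.

Lemma integral_inverse_laplace_pinfty (R : realType) (phi kappa : R -> R) :
  inverse_laplace_kernel phi kappa ->
  phi theta @[theta --> 0^'+] --> 0 ->
  phi theta / theta @[theta --> 0^'+] --> +oo ->
  (\int[lebesgue_measure]_(x in `]0%R, +oo[) (kappa x)%:E = +oo)%E.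
Proof.
move=> [kappa_ge0 _ [mkappa _ _] laplaceE] phi0 phi_div0.
have phi_gt0 : \forall theta \near 0^'+, 0 < phi theta.
  near=> theta; have theta0 : 0 < theta by [].
  have : 0 < phi theta / theta by near: theta; move/cvgryPgt : phi_div0; exact.
  by rewrite pmulr_lgt0// invr_gt0.
have /cvgeryP invphi_y : (phi theta)^-1 @[theta --> 0^'+] --> +oo.
  exact/cvgrVy.
apply/eqP; rewrite -leye_eq; apply: (cvge_to_le invphi_y).
near=> theta; have theta0 : 0 < theta by [].
by rewrite -laplaceE//; exact: laplace_le_integral.
Unshelve. all: end_near. Qed.

Lemma Lp_on1_integrable (R : realType) (D : set R) (f : R -> R) :
  measurable D -> Lp_on 1%E D f -> lebesgue_measure.-integrable D (EFin \o f).
Proof.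
move=> mD /Lfun1_integrable f1; apply/integrable_mkcond => //.
by rewrite restrict_EFin.
Qed.

Lemma Lp_on1_integrable_itvoc (R : realType) (a : R) (f : R -> R) :
  (forall e, 0 < e -> Lp_on 1%E `]a, (a + e)[ f) ->
  forall x, lebesgue_measure.-integrable `]a, x] (EFin \o f).
Proof.
move=> f1 x; have xa0 : 0 < `|x - a| + 1 by rewrite ltr_wpDl.
apply: (integrableS _ _ _ (Lp_on1_integrable _ (f1 _ xa0))) => //.
apply: subset_itvl; rewrite bnd_simp -ltrBlDl.
by rewrite (le_lt_trans (ler_norm _))// ltrDl.
Qed.

Theorem theorem5p3 (R : realType) (phi nu kappa : R -> R)
    (phi_cbf : complete_bernstein phi)
    (nu_cm : completely_monotone nu)
    (nu_levy : levy_density nu)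
    (phi_nu : forall x : R, 0 < x -> (phi x)%:E = levy_exponent nu x)
    (phi_0 : phi theta @[theta --> 0^'+] --> 0)
    (phi_oo : phi theta @[theta --> +oo] --> +oo)
    (phi_div_0 : phi theta / theta @[theta --> 0^'+] --> +oo)
    (phi_div_oo : phi theta / theta @[theta --> +oo] --> 0)
    (kappa_phi : inverse_laplace_kernel phi kappa)
    (kappa_L1 : forall eps : R, 0 < eps -> Lp_on 1%E `]0, eps[ kappa)
    (kappa_L2 : forall eps : R, 0 < eps -> Lp_on 2%:E `]eps, +oo[ kappa)
    (chi_L2 : forall eps : R, 0 < eps -> Lp_on 2%:E `]0, eps[ (chi kappa))
    (d : measure_display) (T : measurableType d) (P : probability T R)
    (W : R -> {RV P >-> R}) (W_wiener : two_sided_wiener W)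
    (B : R -> {RV P >-> R}) (B_def : B_kappa W kappa B) :
  long_range_dependent B.
Proof.
have [kappa_ge0 kappa_noninc _ _] := kappa_phi.
apply: long_range_dependent_B_kappa W_wiener B_def => //.
- by apply: Lp_on1_integrable_itvoc => e; rewrite add0r; exact: kappa_L1.
- exact: integral_inverse_laplace_pinfty kappa_phi phi_0 phi_div_0.
Qed.
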